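(* Let $\Sigma$ be a signature and let $\mathcal G: G_1\sqsubset G_2\sqsubset\cdots$ be a (finite or infinite) strictly ascending sequence of finite E-graphs over $\Sigma$. If the least upper bound $G_\infty=\bigsqcup_i G_i$ is a finite E-graph, then the sequence $\mathcal G$ is finite.
   Context: A signature $\Sigma$ is a finite set of function symbols with arities; $T(\Sigma)$ is the set of ground terms. A (bottom-up) tree automaton $\mathcal A=\langle Q,\Sigma,\Delta\rangle$ (no final states) has a possibly infinite set $Q$ of states and a possibly infinite set $\Delta$ of transitions $f(q_1,\dots,q_n)\to q$ with $f\in\Sigma$ of arity $n$ and $q_i,q\in Q$. Viewing states as nullary symbols, $\to^*_{\mathcal A}$ is the reflexive-transitive closure of rewriting by $\Delta$. $\mathcal A$ is deterministic if $t\to^*_{\mathcal A}q_1$ and $t\to^*_{\mathcal A}q_2$ (with $t\in T(\Sigma)$, $q_1,q_2\in Q$) imply $q_1=q_2$; it is reachable if for every $q\in Q$ there is $t\in T(\Sigma)$ with $t\to^*_{\mathcal A}q$. An E-graph is a deterministic and reachable tree automaton (possibly infinite); it is finite if it has finitely many states and transitions. A homomorphism $h:G\to H$ is a map of states such that for every transition $f(c_1,\dots,c_k)\to c$ of $G$, $f(h(c_1),\dots,h(c_k))\to h(c)$ is a transition of $H$. $G\sqsubseteq H$ means there is a homomorphism $G\to H$; on E-graphs this is a partial order up to isomorphism, and every family of E-graphs has a least upper bound $\bigsqcup$ for it (unique up to isomorphism). $G\sqsubset H$ means $G\sqsubseteq H$ and $G,H$ are not isomorphic (an isomorphism being a homomorphism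 with an inverse homomorphism). *)

(* Defs.v *)
From Stdlib Require Import Relation_Operators.
From mathcomp Require Import all_boot.
From mathcomp Require Import boolp classical_sets cardinality.

Set Implicit Arguments.
Unset Strict Implicit.
Unset Printing Implicit Defensive.

Local Open Scope classical_set_scope.

Record signature := Signature {
  symbol :> finType;
  arity : symbol -> nat
}.

(* [term S X] is the set of terms over S in which the elements of X serve as
   additional nullary symbols; ground terms are the case X = void. *)
Inductive term (S : signature) (X : Type) : Type :=
| Leaf (x : X)
| App (f : S) (args : {ffun 'I_(arity f) -> term S X}).

Arguments Leaf {S X} x.
Arguments App {S X} f args.

Definition gterm (S : signature) : Type := term S void.

(* The inclusion of T(Sigma) into the terms over Sigma and X. *)
Fixpoint incl (S : signature) (X : Type) (t : gterm S) : term S X :=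
  match t with
  | Leaf v => match v with end
  | App f args => App f [ffun i => incl X (args i)]
  end.

(* f(q_1, ..., q_n) -> q *)
Record transition (S : signature) (Q : Type) := Transition {
  tr_sym : S;
  tr_src : {ffun 'I_(arity tr_sym) -> Q};
  tr_dst : Q
}.

Arguments Transition {S Q} tr_sym tr_src tr_dst.

Record automaton (S : signature) := Automaton {
  state : Type;
  delta : set (transition S state)
}.

Section Runs.
Variables (S : signature) (A : automaton S).

Inductive step : term S (state A) -> term S (state A) -> Prop :=
| step_root f (src : {ffun 'I_(arity f) -> state A}) q :
    delta (Transition f src q) ->
    step (App f [ffun i => Leaf (src i)]) (Leaf q)
| step_arg f (args : {ffun 'I_(arity f) -> term S (state A)}) i u :
    step (args i) u ->
    step (App f args) (App f [ffun j => if j == i then u else args j]).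

Definition steps := clos_refl_trans (term S (state A)) step.

Definition deterministic := forall (t : gterm S) (q1 q2 : state A),
  steps (incl _ t) (Leaf q1) -> steps (incl _ t) (Leaf q2) -> q1 = q2.

Definition reachable := forall q : state A,
  exists t : gterm S, steps (incl _ t) (Leaf q).

Definition finite_automaton :=
  finite_set [set: state A] /\ finite_set (@delta S A).

End Runs.

Record egraph (S : signature) := Egraph {
  egraph_automaton :> automaton S;
  egraph_deterministic : deterministic egraph_automaton;
  egraph_reachable : reachable egraph_automaton
}.

Section Order.
Variable S : signature.

Definition homomorphism (G H : egraph S) (h : state G -> state H) :=
  forall (f : S) (c : {ffun 'I_(arity f) -> state G}) (d : state G),
    delta (Transition f c d) ->
    delta (Transition f [ffun i => h (c i)] (h d)).

Definition egraph_le (G H : egraph S) :=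
  exists h : state G -> state H, homomorphism h.

Definition isomorphic (G H : egraph S) :=
  exists (h : state G -> state H) (k : state H -> state G),
    [/\ homomorphism h, homomorphism k, cancel h k & cancel k h].

Definition egraph_lt (G H : egraph S) := egraph_le G H /\ ~ isomorphic G H.

Definition is_lub (T : Type) (I : set T) (G : T -> egraph S) (U : egraph S) :=
  (forall i, I i -> egraph_le (G i) U) /\
  (forall V : egraph S, (forall i, I i -> egraph_le (G i) V) -> egraph_le U V).

(* A finite or infinite sequence is given by its index set I, an initial segment
   of nat, and by G restricted to I; the values of G outside I are irrelevant. *)
Definition initial_segment (I : set nat) :=
  forall i j : nat, (i <= j)%N -> I j -> I i.

Definition strictly_ascending (I : set nat) (G : nat -> egraph S) :=
  forall i : nat, I i -> I i.+1 -> egraph_lt (G i) (G i.+1).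

End Order.

(* Main.v *)
(* An E-graph G amounts to the partial congruence relating t and u when both
   reach the same state of G, and G <= H means inclusion of these relations.
   The relation of the least upper bound of an ascending chain is the union of
   the relations of its members. If the bound is finite, it is determined by
   finitely many equations (a representative for each state, and one equation
   per transition), all of which hold in some G_n; so the bound maps to G_n,
   and any G_(n+1) in the chain would be isomorphic to G_n. *)

Require Import Defs.
From Stdlib Require Import Relation_Operators.
From mathcomp Require Import all_boot.
From mathcomp Require Import boolp classical_sets cardinality.

Set Implicit Arguments.
Unset Strict Implicit.
Unset Printing Implicit Defensive.

Local Open Scope classical_set_scope.

(** Choose an index for each element of [F]. The finitely many chosen indices have a maximum in [I],
    and [P] persists up to it. Nonemptiness of [I] supplies the index when [F] is empty. *)
Lemma finite_common_index (T : Type) (I : set nat) (F : set T)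
    (P : T -> nat -> Prop) :
  finite_set F -> I !=set0 ->
  (forall x i j, I j -> i <= j -> P x i -> P x j) ->
  (forall x, F x -> exists2 i, I i & P x i) ->
  exists2 n, I n & forall x, F x -> P x n.
Proof.
move=> finF [i0 Ii0] monoP exP.
have /choice[k kP] (x : T) : exists i, I i /\ (F x -> P x i).
  have [/exP[i Ii Pxi]|nFx] := EM (F x); first by exists i.
  by exists i0; split.
have [s sE] := (finite_seqP _).1 (finite_image k finF).
have [n In n_max] : exists2 n, I n & forall x, x \in s -> x <= n.
  have : {in s, forall x, I x}.
    by move=> x xs; have : (k @` F) x by [rewrite sE]; case=> y _ <-; case: (kP y).
  elim: s {sE} => [|x s IHs] sI; first by exists i0.
  have [y ys|n In n_max] := IHs; first by apply: sI; rewrite inE ys orbT.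
  exists (maxn x n); first by rewrite /maxn; case: ifP => // _; exact/sI/mem_head.
  move=> y; rewrite inE => /orP[/eqP->|/n_max yn]; first exact: leq_maxl.
  exact: leq_trans yn (leq_maxr _ _).
exists n => // x Fx; have [_ /(_ Fx)] := kP x.
apply: monoP => //; apply: n_max.
by have : (k @` F) (k x) by [exists x]; rewrite sE.
Qed.

(** * Evaluation of terms in an automaton *)

Section Evaluation.
Variable S : signature.

(** The arguments sit inside a finite function, so their induction hypotheses are built by calling
    the fixpoint on each of them. *)
Definition term_nested_ind (X : Type) (P : term S X -> Prop)
    (Pleaf : forall x, P (Leaf x))
    (Papp : forall f (args : {ffun 'I_(arity f) -> term S X}),
       (forall i, P (args i)) -> P (App f args)) :=
  fix loop (t : term S X) : P t :=
    match t with
    | Leaf x => Pleaf x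
    | App f args => Papp f args (fun i => loop (args i))
    end.

(** Big-step form of rewriting to a state: recursion on the term lets runs be decomposed along its
    structure. *)
Fixpoint eval (A : automaton S) (t : term S (state A)) (q : state A) : Prop :=
  match t with
  | Leaf x => x = q
  | App f args => exists src : {ffun 'I_(arity f) -> state A},
      (forall i, eval (args i) (src i)) /\ delta (Transition f src q)
  end.

Lemma step_eval (A : automaton S) (t u : term S (state A)) q :
  step t u -> eval u q -> eval t q.
Proof.
move=> tu; elim: t u / tu q => [f src p dp q /= <-|f args i u _ IH q /=].
  by exists src; split=> // i; rewrite ffunE.
move=> [src [srcP dq]]; exists src; split=> // j.
by have := srcP j; rewrite ffunE; case: eqP => // -> /IH.
Qed.

Lemma steps_App (A : automaton S) (f : S)
    (args args' : {ffun 'I_(arity f) -> term S (state A)}) :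
  (forall i, steps (args i) (args' i)) -> steps (App f args) (App f args').
Proof.
move=> argsP.
(* A run of the single argument [i] lifts to the whole term, the other arguments being frozen as in
   [b]. *)
have step1 i (b : {ffun 'I_(arity f) -> term S (state A)}) u v : steps u v ->
    steps (App f [ffun j => if j == i then u else b j])
          (App f [ffun j => if j == i then v else b j]).
  elim=> {u v} [u v uv|u|u v w _ uv _ vw].
  - have := @step_arg _ A f [ffun j => if j == i then u else b j] i v.
    rewrite ffunE eqxx => /(_ uv) st; apply: rt_step.
    suff <- : [ffun j => if j == i then v
        else [ffun j0 => if j0 == i then u else b j0] j] =
      [ffun j => if j == i then v else b j] by [].
    by apply/ffunP => j; rewrite !ffunE; case: eqP.
  - exact: rt_refl.
  - exact: rt_trans uv vw.
(* The arguments are rewritten one position at a time; those listed in [s] are already done. *)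
pose mix (s : seq 'I_(arity f)) := [ffun j => if j \in s then args' j else args j] :
  {ffun 'I_(arity f) -> term S (state A)}.
have mixP s : steps (App f args) (App f (mix s)).
  elim: s => [|i s IHs].
    suff -> : mix [::] = args by apply: rt_refl.
    by apply/ffunP => j; rewrite ffunE.
  apply: rt_trans IHs _.
  have [si|si] := boolP (i \in s).
    suff -> : mix (i :: s) = mix s by apply: rt_refl.
    by apply/ffunP => j; rewrite !ffunE inE; case: eqP => // ->; rewrite si.
  have := step1 i (mix s) _ _ (argsP i).
  congr (steps (App f _) (App f _)); apply/ffunP => j; rewrite !ffunE ?inE.
    by case: eqP => // ->; rewrite (negbTE si).
  by case: eqP => // ->.
have := mixP (enum 'I_(arity f)); congr (steps _ (App f _)).
by apply/ffunP => j; rewrite ffunE mem_enum.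
Qed.

Lemma stepsE (A : automaton S) (t : term S (state A)) q :
  steps t (Leaf q) <-> eval t q.
Proof.
split.
  move=> tq; have : eval (Leaf q) q by [].
  by elim: tq => [u v /step_eval-/(_ q)|//|u v w _ IH1 _ IH2 /IH2/IH1].
elim/term_nested_ind: t q => [x q ->|f args IH q]; first exact: rt_refl.
move=> [src [srcP dq]].
have argsP : steps (App f args) (App f [ffun i => Leaf (src i)]).
  by apply: steps_App => i; rewrite ffunE; exact: IH (srcP i).
by apply: rt_trans argsP _; apply/rt_step/step_root.
Qed.

Definition reaches (A : automaton S) (t : gterm S) (q : state A) :=
  eval (incl _ t) q.

Lemma reachesE (A : automaton S) f args q :
  reaches (App f args) q <->
  exists src : {ffun 'I_(arity f) -> state A},
    (forall i, reaches (args i) (src i)) /\ delta (Transition f src q).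
Proof.
by split=> -[src [srcP dq]]; exists src; split=> // i; have := srcP i;
  rewrite ffunE.
Qed.

(** * Ground terms as names of states, and the order on E-graphs *)

Lemma reaches_inj (G : egraph S) t (p q : state G) :
  reaches t p -> reaches t q -> p = q.
Proof. by move=> /stepsE tp /stepsE tq; exact: egraph_deterministic tp tq. Qed.

Lemma reaches_ex (G : egraph S) (q : state G) : exists t, reaches t q.
Proof. by have [t /stepsE tq] := egraph_reachable q; exists t. Qed.

Lemma homomorphism_reaches (G H : egraph S) (h : state G -> state H) t q :
  homomorphism h -> reaches t q -> reaches t (h q).
Proof.
move=> hh; elim/term_nested_ind: t q => [[]|f args IH q /reachesE[src [srcP dq]]].
apply/reachesE; exists [ffun i => h (src i)]; split; last exact: hh.
by move=> i; rewrite ffunE; exact: IH.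
Qed.

Lemma egraph_le_refl (G : egraph S) : egraph_le G G.
Proof.
exists id => f c d; congr (delta (Transition f _ d)).
by apply/ffunP => i; rewrite ffunE.
Qed.

Lemma egraph_le_trans (H G K : egraph S) :
  egraph_le G H -> egraph_le H K -> egraph_le G K.
Proof.
move=> [h hh] [k hk]; exists (k \o h) => f c d /hh/hk.
by congr (delta (Transition f _ _)); apply/ffunP => i; rewrite !ffunE.
Qed.

(** Homomorphisms preserve the terms reaching a state, so a term reaching [q] also reaches
    [k (h q)], and determinism identifies the two. *)
Lemma homomorphism_cancel (G H : egraph S) (h : state G -> state H)
    (k : state H -> state G) :
  homomorphism h -> homomorphism k -> cancel h k.
Proof.
move=> hh hk q; have [t tq] := reaches_ex q.
exact: reaches_inj (homomorphism_reaches hk (homomorphism_reaches hh tq)) tq.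
Qed.

Lemma egraph_le_anti (G H : egraph S) :
  egraph_le G H -> egraph_le H G -> isomorphic G H.
Proof.
by move=> [h hh] [k hk]; exists h, k; split=> //; exact: homomorphism_cancel.
Qed.

(** * The partial congruence of an E-graph on ground terms *)

Definition equated (G : egraph S) (t u : gterm S) :=
  exists q : state G, reaches t q /\ reaches u q.

Lemma equated_sym (G : egraph S) t u : equated G t u -> equated G u t.
Proof. by move=> [q [tq uq]]; exists q. Qed.

Lemma equated_trans (G : egraph S) u t v :
  equated G t u -> equated G u v -> equated G t v.
Proof.
move=> [q [tq uq]] [p [up vp]]; exists q; split=> //.
by rewrite (reaches_inj uq up).
Qed.

Lemma equated_le (G H : egraph S) t u :
  egraph_le G H -> equated G t u -> equated H t u.
Proof.
move=> [h hh] [q [tq uq]]; exists (h q).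
by split; exact: homomorphism_reaches.
Qed.

Lemma equated_arg (G : egraph S) f (a : {ffun 'I_(arity f) -> gterm S}) i :
  equated G (App f a) (App f a) -> equated G (a i) (a i).
Proof. by move=> [q [/reachesE[src [srcP _]] _]]; exists (src i). Qed.

(** The second hypothesis says that [App f a] reaches a state at all, which equations between the
    arguments do not ensure. *)
Lemma equated_App (G : egraph S) f (a b : {ffun 'I_(arity f) -> gterm S}) :
  (forall i, equated G (a i) (b i)) -> equated G (App f a) (App f a) ->
  equated G (App f a) (App f b).
Proof.
move=> ab [q [aq _]]; exists q; split=> //.
have /reachesE[src [srcP dq]] := aq.
apply/reachesE; exists src; split=> // i.
by have [p [ap bp]] := ab i; rewrite (reaches_inj (srcP i) ap).
Qed.

End Evaluation.

(** * The union of an ascending chain of E-graphs *)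

Section Union.
Variables (S : signature) (I : set nat) (G : nat -> egraph S).
Hypothesis G_le : forall i j, I j -> i <= j -> egraph_le (G i) (G j).

Definition union_equated (t u : gterm S) := exists2 i, I i & equated (G i) t u.

Lemma union_equated_sym t u : union_equated t u -> union_equated u t.
Proof. by move=> [i Ii /equated_sym]; exists i. Qed.

Lemma union_equated_common t u i :
  union_equated t u -> I i ->
  exists k, [/\ I k, i <= k & equated (G k) t u].
Proof.
move=> [j Ij tu] Ii; have [ij|/ltnW ji] := leqP i j; first by exists j.
by exists i; split=> //; apply: equated_le tu; exact: G_le.
Qed.

Lemma union_equated_trans u t v :
  union_equated t u -> union_equated u v -> union_equated t v.
Proof.
move=> [i Ii tu] /union_equated_common/(_ Ii)[k [Ik ik uv]].
by exists k => //; apply: equated_trans uv; apply: equated_le tu; exact: G_le.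
Qed.

(** The hypothesis excludes terms outside the domain of the relation: all of these have the empty
    class without being equated. *)
Lemma union_equated_class t u :
  union_equated u u -> union_equated t = union_equated u <-> union_equated t u.
Proof.
move=> uu; split=> [->//|tu]; apply/funext => v; apply/propext; split.
  exact: union_equated_trans (union_equated_sym tu).
exact: union_equated_trans.
Qed.

Lemma union_equated_arg f (a : {ffun 'I_(arity f) -> gterm S}) i :
  union_equated (App f a) (App f a) -> union_equated (a i) (a i).
Proof. by move=> [n In /(equated_arg i)]; exists n. Qed.

(** Arities are finite, so one member of the chain contains the equations for all arguments; a later
    one also makes [App f a] defined. *)
Lemma union_equated_App f (a b : {ffun 'I_(arity f) -> gterm S}) :
  (forall i, union_equated (a i) (b i)) -> union_equated (App f a) (App f a) ->
  union_equated (App f a) (App f b).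
Proof.
move=> ab fa.
have [|||i _|n In abn] := @finite_common_index _ I [set: 'I_(arity f)]
  (fun i k => equated (G k) (a i) (b i)); first exact: finite_finset.
- by case: fa => n In _; exists n.
- by move=> i j k Ik jk; apply: equated_le; exact: G_le.
- exact: ab.
have [k [Ik nk fak]] := union_equated_common fa In.
exists k => //; apply: equated_App fak => i.
by apply: equated_le (abn i Logic.I); exact: G_le.
Qed.

(** The quotient of the domain of [union_equated], with classes represented as sets of terms. *)
Definition union_state :=
  {P : set (gterm S) | exists2 t, union_equated t t & P = union_equated t}.

Definition union_class t (tt : union_equated t t) : union_state :=
  exist _ (union_equated t) (ex_intro2 (fun u => union_equated u u)
    (fun u => union_equated t = union_equated u) t tt erefl).

Definition union_automaton := @Automaton S union_state
  [set tr | exists ts : {ffun 'I_(arity (tr_sym tr)) -> gterm S},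
    [/\ forall i, sval (tr_src tr i) = union_equated (ts i),
        sval (tr_dst tr) = union_equated (App (tr_sym tr) ts) &
        union_equated (App (tr_sym tr) ts) (App (tr_sym tr) ts)]].

Lemma union_reaches t (q : state union_automaton) :
  reaches t q <-> union_equated t t /\ sval q = union_equated t.
Proof.
elim/term_nested_ind: t q => [[]|f args IH q]; split.
  move=> /reachesE[src [srcP [ts /= [tsP qE fts]]]].
  (* The terms [ts] witnessing the transition may differ from [args], but they represent the same
     classes. *)
  have ts_args i : union_equated (ts i) (args i).
    have /IH[args_i argsE] := srcP i.
    by apply/(union_equated_class _ args_i); rewrite -argsE -tsP.
  have fa := union_equated_App ts_args fts.
  have faa := union_equated_trans (union_equated_sym fa) fa.
  by split=> //; rewrite qE; apply/union_equated_class.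
move=> [fa qE]; apply/reachesE.
exists [ffun i => union_class (union_equated_arg i fa)]; split.
  by move=> i; rewrite ffunE; apply/IH; split=> //; exact: union_equated_arg fa.
by exists args; split=> //= i; rewrite ffunE.
Qed.

Lemma union_deterministic : deterministic union_automaton.
Proof.
move=> t [P Pt] [Q Qt] /stepsE/union_reaches[_ /= PE] /stepsE/union_reaches[_ /= QE].
by apply: eq_exist; rewrite PE QE.
Qed.

Lemma union_reachable : reachable union_automaton.
Proof.
move=> [P Pt]; have [t tt PE] := Pt.
by exists t; apply/stepsE/union_reaches.
Qed.

Definition union_egraph := Egraph union_deterministic union_reachable.

(** A state goes to the class of any ground term [r q] that reaches it. *)
Lemma le_union_egraph i : I i -> egraph_le (G i) union_egraph.
Proof.
move=> Ii; have /choice[r rP] := @reaches_ex _ (G i).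
have rr q : union_equated (r q) (r q) by exists i => //; exists q.
exists (fun q => union_class (rr q)) => f c d cd.
have fr : reaches (App f [ffun j => r (c j)]) d.
  by apply/reachesE; exists c; split=> // j; rewrite ffunE.
exists [ffun j => r (c j)] => /=; split=> [j||]; first by rewrite !ffunE.
  by apply/union_equated_class; exists i => //; exists d.
by exists i => //; exists d.
Qed.

(** [H] is presented by finitely many equations between representatives of its states. They all hold
    in one [G k], where evaluating the representatives gives the homomorphism. *)
Lemma finite_le_union_egraph (H : egraph S) :
  I !=set0 -> finite_automaton H -> egraph_le H union_egraph ->
  exists2 n, I n & egraph_le H (G n).
Proof.
move=> I0 [finQ finD] [h hh].
have /choice[r rP] (q : state H) :
    exists t, union_equated t t /\ sval (h q) = union_equated t.
  by case: (h q) => P /= [t tt PE]; exists t.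
have mono t u i j : I j -> i <= j -> equated (G i) t u -> equated (G j) t u.
  by move=> Ij ij; apply: equated_le; exact: G_le.
have [n In nP] : exists2 n, I n &
    forall q : state H, [set: state H] q -> equated (G n) (r q) (r q).
  apply: finite_common_index => // [q i j|q _]; first exact: mono.
  by have [] := rP q.
(* The left-hand side of [tr] with states replaced by representatives; [tr] becomes the equation
   between [tm tr] and the representative of its target. *)
pose tm (tr : transition S (state H)) :=
  App (tr_sym tr) [ffun i => r (tr_src tr i)].
have [m Im mP] : exists2 m, I m &
    forall tr, delta tr -> equated (G m) (tm tr) (r (tr_dst tr)).
  apply: finite_common_index => // [tr i j|]; first exact: mono.
  move=> [f c d] /hh[ts /= [tsP dE fts]].
  have [dd dE'] := rP d.
  apply: (@union_equated_trans (App f ts)).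
    apply/union_equated_sym/union_equated_App => // i; rewrite ffunE.
    have [cc cE] := rP (c i); apply/union_equated_class => //.
    by rewrite -tsP ffunE.
  by apply/union_equated_class; rewrite // -dE.
pose k := maxn n m; have Ik : I k by rewrite /k /maxn; case: ifP.
have /choice[g gP] (q : state H) : exists p : state (G k), reaches (r q) p.
  have [p [rp _]] := mono _ _ _ _ Ik (leq_maxl n m) (nP q Logic.I).
  by exists p.
exists k => //; exists g => f c d /mP /=.
move=> /(mono _ _ _ _ Ik (leq_maxr n m))[p [/reachesE[src [srcP dp]] rp]].
(* Determinism of [G k] forces the run on the left-hand side to pass through the states
   [g (c i)]. *)
have <- : src = [ffun i => g (c i)].
  apply/ffunP => i; rewrite ffunE; apply: reaches_inj (srcP i) _.
  by rewrite ffunE.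
by rewrite (reaches_inj (gP d) rp).
Qed.

End Union.

Theorem lemma26 (S : signature) (I : set nat) (G : nat -> egraph S)
    (Ginf : egraph S) :
  initial_segment I ->
  (forall i : nat, I i -> finite_automaton (G i)) ->
  strictly_ascending I G ->
  is_lub I G Ginf ->
  finite_automaton Ginf ->
  finite_set I.
Proof.
move=> segI _ ascG [ubG lubG] finGinf.
have G_le i j : I j -> i <= j -> egraph_le (G i) (G j).
  elim: j => [|j IHj] Ij; first by rewrite leqn0 => /eqP->; exact: egraph_le_refl.
  rewrite leq_eqVlt ltnS => /predU1P[->|ij]; first exact: egraph_le_refl.
  have Ij' : I j := segI _ _ (leqnSn j) Ij.
  by apply: egraph_le_trans (IHj Ij' ij) _; case: (ascG j Ij' Ij).
have [->//|/set0P I0] := eqVneq I set0.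
(* The union is an upper bound of the chain, so the least upper bound maps into it and hence into
   some [G n]. *)
have [n In Ginf_n] := finite_le_union_egraph I0 finGinf
  (lubG _ (@le_union_egraph _ _ _ G_le)).
(* No index exceeds [n]: otherwise [n.+1] lies in [I], and [G n.+1] maps to [Ginf] and back down to
   [G n], against strictness. *)
apply: (sub_finite_set _ (finite_II n.+1)) => i Ii /=.
rewrite ltnNge; apply/negP => ni; have In1 := segI _ _ ni Ii.
have [le_n] := ascG n In In1; apply.
by apply: egraph_le_anti le_n (egraph_le_trans (ubG _ In1) Ginf_n).
Qed.
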